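(* Let $n\in\mathbb{N}=\{1,2,3,\dots\}$, let $\nu,\alpha,\beta\in\mathbb{R}$ with $n-1<\nu<n$, $\alpha>-1$, $\beta>0$. Then the C-Jacobi function $y(x)=P_\nu^{(\alpha,\beta)}(x)$ satisfies, for all $x\in(-1,1)$, the differential equation $$(1-x^2)\,y''(x)+\bigl(\beta-\alpha-(\alpha+\beta+2)x\bigr)\,y'(x)+\nu(\nu+\alpha+\beta+1)\,y(x)=0 .$$
   Context: For $n\in\mathbb{N}$, $n-1<\nu<n$ and $x>a$, the Caputo fractional derivative of order $\nu$ with lower terminal $a$ is $${}_aD^\nu_*f(x)=\frac{1}{\Gamma(n-\nu)}\int_a^x\frac{f^{(n)}(\tau)}{(x-\tau)^{\nu+1-n}}\,d\tau .$$ For $n-1<\nu<n$ and $x\in(-1,1)$ the C-Jacobi function $P_\nu^{(\alpha,\beta)}$ is defined by $$(1-x)^\alpha(1+x)^\beta P_\nu^{(\alpha,\beta)}(x)=\frac{(-1)^\nu}{2^\nu\,\Gamma(\nu+1)}\;{}_{-1}D^\nu_*\left[(1-x)^{\nu+\alpha}(1+x)^{\nu+\beta}\right],$$ where $(-1)^s:=e^{i\pi s}$ for real $s$. *)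

(* Defs.v *)
From Stdlib Require Import Reals.
From Coquelicot Require Import Coquelicot.
Open Scope R_scope.

(* Euler's integral of the second kind: this is Gamma only for p > 0, the only
   range in which it is used. *)
Definition Gamma (p : R) : R :=
  RInt_gen (fun t => Rpower t (p - 1) * exp (- t))
    (at_right 0) (Rbar_locally p_infty).

(* Only meaningful for n - 1 < nu < n.  The kernel is singular at x, and the
   n-th derivative of f need only exist inside (a, x) and may be unbounded near
   a, so the integral is improper at both ends. *)
Definition caputo (n : nat) (nu a : R) (f : R -> R) (x : R) : R :=
  / Gamma (INR n - nu) *
  RInt_gen (fun tau => Derive_n f n tau / Rpower (x - tau) (nu + 1 - INR n))
    (at_right a) (at_left x).

Definition Cexp (z : C) : C := (RtoC (exp (Re z)) * (cos (Im z), sin (Im z)))%C.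

Definition minus_one_pow (s : R) : C := Cexp (Ci * RtoC (PI * s))%C.

Definition jacobi_weight (alpha beta x : R) : R :=
  Rpower (1 - x) alpha * Rpower (1 + x) beta.

(* n is determined by nu through n - 1 < nu < n.  Rpower t s is the real power
   t^s only for t > 0; outside (-1, 1) the values of jacobi_weight, and hence
   of c_jacobi, are meaningless. *)
Definition c_jacobi (n : nat) (nu alpha beta : R) (x : R) : C :=
  (minus_one_pow nu / RtoC (Rpower 2 nu * Gamma (nu + 1))
   * RtoC (caputo n nu (-1) (jacobi_weight (nu + alpha) (nu + beta)) x)
   / RtoC (jacobi_weight alpha beta x))%C.

Lemma c_jacobiE (n : nat) (nu alpha beta x : R) :
  (RtoC (jacobi_weight alpha beta x) * c_jacobi n nu alpha beta x =
   minus_one_pow nu / RtoC (Rpower 2 nu * Gamma (nu + 1))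
   * RtoC (caputo n nu (-1) (jacobi_weight (nu + alpha) (nu + beta)) x))%C.
Proof.
assert (Hw : RtoC (jacobi_weight alpha beta x) <> 0%C).
{ intros H; apply RtoC_inj in H; revert H.
  apply Rgt_not_eq, Rmult_lt_0_compat; apply exp_pos. }
unfold c_jacobi.
set (A := (_ * RtoC (caputo _ _ _ _ _))%C); clearbody A.
now field.
Qed.

(* Main.v *)
Require Import Defs.
From Stdlib Require Import Reals Lra Lia.
From Coquelicot Require Import Coquelicot.
Open Scope R_scope.

(** Put [u = 1 + x], [r = nu + beta] and [mu = nu + alpha].  As a function of
    [v = 1 + t], the weight to be differentiated is [v^r (2 - v)^mu], that is [v^r]
    times the binomial series of [(2 - v)^mu], which converges for [|v| < 2]
    ([PSeries_binomial]).  Its [n]-th derivative is therefore [v^(r - n)] times an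
    explicit power series [h] ([Derive_n_power_PSeries]).

    The substitution [t = -1 + u s] turns the Caputo integral into [u^beta] times
    the integral over [(0, 1)] of the beta weight [s^(r - n) (1 - s)^(n - nu - 1)]
    against [h (u s)].  Since [beta > 0] and [n - 1 < nu < n], both exponents exceed
    [-1]: the weight is integrable, and the power series can be integrated term by
    term ([is_pseries_beta_PSeries]).  Each term gives a value of the Beta function,
    so the Caputo derivative is [u^beta G u] for a power series [G]
    ([caputo_jacobi_weight]).

    The recurrence of the binomial coefficients, the functional equation of the Beta
    function ([Beta_succ]) and a telescoping identity between falling factorials
    together give a two-term recurrence for the coefficients of [G]
    ([caputo_coef_succ]).  It is the recurrence of the hypergeometric function
    [2F1 (- nu - alpha, nu + beta + 1; beta + 1; u / 2)], whence a second-order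
    equation for [G] ([hypergeometric_ODE]).

    Dividing by the Jacobi weight cancels [u^beta] and leaves a complex constant times
    [(1 - x)^(- alpha) G (1 + x)].  Rewriting the equation of [G] for this product gives
    Jacobi's equation ([jacobi_of_hypergeometric]). *)

(** * Real powers *)

Lemma Rpower_pos (x y : R) : 0 < Rpower x y.
Proof. apply exp_pos. Qed.

Lemma is_derive_Rpower (x y : R) : 0 < x ->
  is_derive (fun t => Rpower t y) x (y * Rpower x (y - 1)).
Proof. intros Hx; apply is_derive_Reals, derivable_pt_lim_power, Hx. Qed.

Lemma is_derive_Rpower_comp (f : R -> R) (df x y : R) : 0 < f x ->
  is_derive f x df ->
  is_derive (fun t => Rpower (f t) y) x (df * (y * Rpower (f x) (y - 1))).
Proof.
intros Hx Hf.
apply (is_derive_comp (fun t => Rpower t y) f); [now apply is_derive_Rpower | exact Hf].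
Qed.

Lemma continuous_Rpower (x y : R) : 0 < x -> continuous (fun t => Rpower t y) x.
Proof.
intros Hx; apply (ex_derive_continuous (V := R_NormedModule)).
  now eexists; apply is_derive_Rpower.
Qed.

Lemma Rpower_succ (x y : R) : 0 < x -> Rpower x (y + 1) = x * Rpower x y.
Proof. intros Hx; rewrite Rpower_plus, Rpower_1; [ring | exact Hx]. Qed.

Lemma Rpower_pred (x y : R) : 0 < x -> Rpower x y = x * Rpower x (y - 1).
Proof. intros Hx; rewrite <- Rpower_succ by exact Hx; f_equal; ring. Qed.

Lemma filterlim_Rpower_0 (y : R) : 0 < y ->
  filterlim (fun s => Rpower s y) (at_right 0) (locally 0).
Proof.
intros Hy P [eps HP].
assert (Hd : 0 < Rpower eps (/ y)) by apply Rpower_pos.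
exists (mkposreal _ Hd); intros s Hs Hs0; apply HP.
change (Rabs (s - 0) < Rpower eps (/ y)) in Hs.
change (Rabs (Rpower s y - 0) < eps).
rewrite Rminus_0_r in *.
rewrite Rabs_pos_eq in Hs by lra.
rewrite Rabs_pos_eq by (left; apply Rpower_pos).
replace (pos eps) with (Rpower (Rpower eps (/ y)) y).
- apply Rlt_Rpower_l; lra.
- rewrite Rpower_mult, Rinv_l, Rpower_1; [reflexivity | apply cond_pos | lra].
Qed.

(** * Improper integrals over an open interval *)

Lemma at_right_Ioo (a b : R) : a < b -> at_right a (fun s => a < s < b).
Proof.
intros H; assert (Hd : 0 < b - a) by lra.
exists (mkposreal _ Hd); intros s Hs Has.
change (Rabs (s - a) < b - a) in Hs; apply Rabs_def2 in Hs; lra.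
Qed.

Lemma at_left_Ioo (a b : R) : a < b -> at_left b (fun s => a < s < b).
Proof.
intros H; assert (Hd : 0 < b - a) by lra.
exists (mkposreal _ Hd); intros s Hs Has.
change (Rabs (s - b) < b - a) in Hs; apply Rabs_def2 in Hs; lra.
Qed.

Lemma filter_prod_Ioo (a b : R) : a < b ->
  filter_prod (at_right a) (at_left b) (fun st => a < fst st < snd st /\ snd st < b).
Proof.
intros H.
exists (fun s => a < s < (a + b) / 2) (fun t => (a + b) / 2 < t < b).
- apply at_right_Ioo; lra.
- apply at_left_Ioo; lra.
- simpl; intros; lra.
Qed.

(** The open segment between two points near the ends stays inside [(a, b)], so the
    integrands need to agree there only. *)
Lemma is_RInt_gen_ext_Ioo (a b : R) (f g : R -> R) (l : R) : a < b ->
  (forall s, a < s < b -> f s = g s) ->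
  is_RInt_gen f (at_right a) (at_left b) l -> is_RInt_gen g (at_right a) (at_left b) l.
Proof.
intros Hab Hfg.
apply is_RInt_gen_ext.
generalize (filter_prod_Ioo a b Hab); apply filter_imp.
intros [s t]; simpl; intros Hst x.
rewrite Rmin_left, Rmax_right by lra; intros Hx; apply Hfg; lra.
Qed.

Lemma ex_RInt_Ioo (a b : R) (g : R -> R) :
  (forall s, a < s < b -> continuous g s) ->
  forall s t, a < s < b -> a < t < b -> ex_RInt g s t.
Proof.
intros Hg s t Hs Ht; apply (ex_RInt_continuous (V := R_CompleteNormedModule)).
intros z Hz; apply Hg.
destruct (Rle_dec s t).
- rewrite Rmin_left, Rmax_right in Hz by lra; lra.
- rewrite Rmin_right, Rmax_left in Hz by lra; lra.
Qed.

(** Stated with an absolute value on both sides so that the order of [s] and [t]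
    does not matter. *)
Lemma RInt_dominated (a b : R) (g D d : R -> R) :
  (forall s, a < s < b -> continuous g s) ->
  (forall s, a < s < b -> is_derive D s (d s)) ->
  (forall s, a < s < b -> continuous d s) ->
  (forall s, a < s < b -> Rabs (g s) <= d s) ->
  forall s t, a < s < b -> a < t < b -> Rabs (RInt g s t) <= Rabs (D t - D s).
Proof.
intros Hg HD Hd Hgd.
assert (H : forall s t, a < s < b -> a < t < b -> s <= t ->
  Rabs (RInt g s t) <= Rabs (D t - D s)).
{ intros s t Hs Ht Hst.
  apply Rle_trans with (2 := Rle_abs _).
  apply (norm_RInt_le g d s t _ _ Hst).
  - intros x Hx; apply Hgd; lra.
  - now apply (RInt_correct g), (ex_RInt_Ioo a b).
  - apply (is_RInt_derive D d); rewrite Rmin_left, Rmax_right by lra; intros x Hx.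
    + apply HD; lra.
    + apply Hd; lra. }
intros s t Hs Ht; destruct (Rle_dec s t).
- now apply H.
- rewrite <- opp_RInt_swap by (apply (ex_RInt_Ioo a b); auto).
  change (opp ?x) with (- x); rewrite Rabs_Ropp, (Rabs_minus_sym (D t)).
  apply H; lra.
Qed.

(** Comparison test at both ends at once: the integral of [g] over a short piece
    near an end is controlled by the oscillation there of a primitive [D] of the
    dominating function, so the partial integrals form a Cauchy net. *)
Lemma ex_RInt_gen_dominated (a b : R) (g D d : R -> R) (da db : R) : a < b ->
  (forall s, a < s < b -> continuous g s) ->
  (forall s, a < s < b -> is_derive D s (d s)) ->
  (forall s, a < s < b -> continuous d s) ->
  (forall s, a < s < b -> Rabs (g s) <= d s) ->
  filterlim D (at_right a) (locally da) ->
  filterlim D (at_left b) (locally db) ->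
  ex_RInt_gen g (at_right a) (at_left b).
Proof.
intros Hab Hg HD Hd Hgd Ha Hb.
pose proof (RInt_dominated a b g D d Hg HD Hd Hgd) as Hdom.
pose proof (ex_RInt_Ioo a b g Hg) as Hex.
apply (filterlimi_locally_cauchy (U := R_CompleteNormedModule)).
{ generalize (filter_prod_Ioo a b Hab); apply filter_imp.
  intros [s t]; simpl; intros Hst; split.
  - apply (Hex s t); lra.
  - intros y1 y2 H1 H2.
    now rewrite <- (is_RInt_unique _ _ _ _ H1), <- (is_RInt_unique _ _ _ _ H2). }
intros eps.
assert (He : 0 < eps / 4) by (generalize (cond_pos eps); lra).
set (e := mkposreal _ He).
exists (fun st => (a < fst st < b /\ ball da e (D (fst st))) /\
  (a < snd st < b /\ ball db e (D (snd st)))); split.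
{ exists (fun s => a < s < b /\ ball da e (D s)) (fun s => a < s < b /\ ball db e (D s)).
  - apply filter_and; [now apply at_right_Ioo | apply Ha; exists e; auto].
  - apply filter_and; [now apply at_left_Ioo | apply Hb; exists e; auto].
  - simpl; auto. }
intros [s t] [s' t']; simpl; intros [[Hs HDs] [Ht HDt]] [[Hs' HDs'] [Ht' HDt']] y y' Hy Hy'.
change (Rabs (D s - da) < eps / 4) in HDs.
change (Rabs (D s' - da) < eps / 4) in HDs'.
change (Rabs (D t - db) < eps / 4) in HDt.
change (Rabs (D t' - db) < eps / 4) in HDt'.
change (Rabs (y' - y) < eps).
rewrite <- (is_RInt_unique _ _ _ _ Hy), <- (is_RInt_unique _ _ _ _ Hy').
rewrite <- (RInt_Chasles g s' s t') by auto.
rewrite <- (RInt_Chasles g s t t') by auto.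
unfold plus; simpl.
(* [D] oscillates by less than [eps / 2] near each end. *)
pose proof (Hdom s' s Hs' Hs) as Hl; pose proof (Hdom t t' Ht Ht') as Hr.
assert (Hl2 : Rabs (D s - D s') < eps / 2).
{ apply Rabs_def2 in HDs; apply Rabs_def2 in HDs'; apply Rabs_def1; lra. }
assert (Hr2 : Rabs (D t' - D t) < eps / 2).
{ apply Rabs_def2 in HDt; apply Rabs_def2 in HDt'; apply Rabs_def1; lra. }
set (I1 := RInt g s' s) in *; set (I2 := RInt g t t') in *; set (I := RInt g s t).
replace (I1 + (I + I2) - I) with (I1 + I2) by ring.
generalize (Rabs_triang I1 I2); lra.
Qed.

Lemma is_RInt_gen_affine (a b : R) (g : R -> R) (l : R) : a < b ->
  is_RInt_gen g (at_right 0) (at_left 1) l ->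
  is_RInt_gen (fun t => / (b - a) * g ((t - a) / (b - a))) (at_right a) (at_left b) l.
Proof.
intros Hab H P HP.
destruct (H P HP) as [Q S [dQ HQ] [dS HS] HQS].
assert (Hba : 0 < b - a) by lra.
assert (Hpos : 0 < / (b - a)) by now apply Rinv_0_lt_compat.
assert (Hscale : forall c t (d : posreal), Rabs (t - c) < d * (b - a) ->
  Rabs ((t - c) / (b - a)) < d).
{ intros c t d Ht; unfold Rdiv.
  rewrite Rabs_mult, (Rabs_pos_eq (/ (b - a))) by lra.
  apply Rmult_lt_reg_r with (b - a); [lra|].
  now rewrite Rmult_assoc, Rinv_l, Rmult_1_r by lra. }
exists (fun t => Q ((t - a) / (b - a))) (fun t => S ((t - a) / (b - a))).
- assert (Hd : 0 < dQ * (b - a)) by (apply Rmult_lt_0_compat; [apply cond_pos | lra]).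
  exists (mkposreal _ Hd); intros t Ht Hat; apply HQ.
  + change (Rabs ((t - a) / (b - a) - 0) < dQ).
    now rewrite Rminus_0_r; apply Hscale.
  + apply Rdiv_lt_0_compat; lra.
- assert (Hd : 0 < dS * (b - a)) by (apply Rmult_lt_0_compat; [apply cond_pos | lra]).
  exists (mkposreal _ Hd); intros t Ht Htb; apply HS.
  + change (Rabs ((t - a) / (b - a) - 1) < dS).
    replace ((t - a) / (b - a) - 1) with ((t - b) / (b - a)) by (field; lra).
    now apply Hscale.
  + apply Rmult_lt_reg_r with (b - a); [lra|].
    unfold Rdiv; rewrite Rmult_assoc, Rinv_l; lra.
- intros s t Hs Ht; destruct (HQS _ _ Hs Ht) as [y [Hy HPy]].
  exists y; split; [|exact HPy]; simpl in *.
  apply is_RInt_ext with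
    (fun y => scal (/ (b - a)) (g (/ (b - a) * y + (- a / (b - a))))).
  + intros z _; unfold scal; simpl; unfold mult; simpl.
    f_equal; f_equal; field; lra.
  + apply (is_RInt_comp_lin g).
    replace (/ (b - a) * s + - a / (b - a)) with ((s - a) / (b - a)) by (field; lra).
    replace (/ (b - a) * t + - a / (b - a)) with ((t - a) / (b - a)) by (field; lra).
    exact Hy.
Qed.

(** * The beta weight *)

Lemma filterlim_Rplus {T : Type} {F : (T -> Prop) -> Prop} {FF : Filter F}
  (f g : T -> R) (lf lg : R) :
  filterlim f F (locally lf) -> filterlim g F (locally lg) ->
  filterlim (fun t => f t + g t) F (locally (lf + lg)).
Proof.
intros Hf Hg; apply (filterlim_comp_2 f g Rplus Hf Hg).
apply (filterlim_plus (V := R_NormedModule)).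
Qed.

Lemma filterlim_Rmult {T : Type} {F : (T -> Prop) -> Prop} {FF : Filter F}
  (f g : T -> R) (lf lg : R) :
  filterlim f F (locally lf) -> filterlim g F (locally lg) ->
  filterlim (fun t => f t * g t) F (locally (lf * lg)).
Proof.
intros Hf Hg; apply (filterlim_comp_2 f g Rmult Hf Hg).
apply (filterlim_mult (K := R_AbsRing)).
Qed.

Lemma filterlim_Rpower_at_left_1 (y : R) :
  filterlim (fun s => Rpower s y) (at_left 1) (locally 1).
Proof.
replace 1 with (Rpower 1 y) at 2 by (unfold Rpower; rewrite ln_1, Rmult_0_r, exp_0; reflexivity).
eapply filterlim_filter_le_1; [apply filter_le_within|].
apply (continuous_Rpower 1 y); lra.
Qed.

Lemma filterlim_one_minus_at_left_1 : filterlim (fun s => 1 - s) (at_left 1) (at_right 0).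
Proof.
intros P [eps HP]; exists eps; intros s Hs Hs1.
change (Rabs (s - 1) < eps) in Hs; apply HP; [|lra].
change (Rabs (1 - s - 0) < eps).
now replace (1 - s - 0) with (- (s - 1)) by ring; rewrite Rabs_Ropp.
Qed.

Lemma filterlim_one_minus_at_right_0 : filterlim (fun s => 1 - s) (at_right 0) (at_left 1).
Proof.
intros P [eps HP]; exists eps; intros s Hs Hs0.
change (Rabs (s - 0) < eps) in Hs; apply HP; [|lra].
change (Rabs (1 - s - 1) < eps).
now replace (1 - s - 1) with (- (s - 0)) by ring; rewrite Rabs_Ropp.
Qed.

Definition beta_weight (p q s : R) : R := Rpower s p * Rpower (1 - s) q.

Definition Beta (p q : R) : R := RInt_gen (beta_weight p q) (at_right 0) (at_left 1).

Lemma beta_weight_pos (p q s : R) : 0 < beta_weight p q s.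
Proof. apply Rmult_lt_0_compat; apply Rpower_pos. Qed.

Lemma beta_weight_addl (p q s : R) (j : nat) : 0 < s ->
  beta_weight (p + INR j) q s = beta_weight p q s * s ^ j.
Proof.
intros Hs; unfold beta_weight; rewrite Rpower_plus, Rpower_pow by exact Hs; ring.
Qed.

Lemma is_derive_beta_weight (p q s : R) : 0 < s < 1 ->
  is_derive (beta_weight (p + 1) (q + 1)) s
    ((p + 1) * beta_weight p q s - (p + q + 2) * beta_weight (p + 1) q s).
Proof.
intros Hs.
assert (H1 : is_derive (fun s => Rpower (1 - s) (q + 1)) s
   (- 1 * ((q + 1) * Rpower (1 - s) (q + 1 - 1)))).
{ apply is_derive_Rpower_comp; [lra|]; auto_derive; [trivial | ring]. }
assert (H0 : is_derive (fun s => Rpower s (p + 1)) s ((p + 1) * Rpower s (p + 1 - 1))).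
{ apply is_derive_Rpower; lra. }
replace (p + 1 - 1) with p in H0 by ring.
replace (q + 1 - 1) with q in H1 by ring.
evar_last.
- apply (is_derive_mult _ _ _ _ _ H0 H1); intros; apply Rmult_comm.
- unfold plus, mult, beta_weight; simpl.
  rewrite !Rpower_succ by lra; ring.
Qed.

Lemma continuous_beta_weight (p q s : R) : 0 < s < 1 -> continuous (beta_weight p q) s.
Proof.
intros Hs.
replace p with (p - 1 + 1) by ring; replace q with (q - 1 + 1) by ring.
apply (ex_derive_continuous (V := R_NormedModule)); eexists.
now apply is_derive_beta_weight.
Qed.

(** Away from the end where it is singular, each factor of the beta weight is bounded
    by a constant that serves for either sign of its exponent. *)
Lemma Rpower_le_half (t y : R) : / 2 <= t <= 1 -> Rpower t y <= Rpower 2 (Rabs y).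
Proof.
intros Ht; unfold Rpower.
assert (Hl : - ln 2 <= ln t <= 0).
{ split.
  - rewrite <- ln_Rinv by lra; apply ln_le; lra.
  - rewrite <- ln_1; apply ln_le; lra. }
assert (H : y * ln t <= Rabs y * ln 2).
{ apply Rle_trans with (1 := Rle_abs _); rewrite Rabs_mult.
  apply Rmult_le_compat_l; [apply Rabs_pos|].
  rewrite Rabs_left1; lra. }
destruct H as [H|H]; [left; now apply exp_increasing | rewrite H; apply Rle_refl].
Qed.

(** Replaces the product by a sum of powers, which has an elementary primitive. *)
Lemma beta_weight_le (p q s : R) : 0 < s < 1 ->
  beta_weight p q s <=
  (Rpower 2 (Rabs p) + Rpower 2 (Rabs q)) * (Rpower s p + Rpower (1 - s) q).
Proof.
intros Hs; unfold beta_weight.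
pose proof (Rpower_pos s p); pose proof (Rpower_pos (1 - s) q).
pose proof (Rpower_pos 2 (Rabs p)); pose proof (Rpower_pos 2 (Rabs q)).
destruct (Rle_dec s (/ 2)).
- assert (Rpower (1 - s) q <= Rpower 2 (Rabs q)) by (apply Rpower_le_half; lra).
  nra.
- assert (Rpower s p <= Rpower 2 (Rabs p)) by (apply Rpower_le_half; lra).
  nra.
Qed.

(** Comparison with the bound of [beta_weight_le]: its primitive has finite limits at
    both ends because the exponents exceed [-1]. *)
Lemma ex_RInt_gen_beta (p q M : R) (phi : R -> R) : -1 < p -> -1 < q ->
  (forall s, 0 < s < 1 -> continuous phi s) ->
  (forall s, 0 < s < 1 -> Rabs (phi s) <= M) ->
  ex_RInt_gen (fun s => beta_weight p q s * phi s) (at_right 0) (at_left 1).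
Proof.
intros Hp Hq Hphi HM.
set (K := (Rpower 2 (Rabs p) + Rpower 2 (Rabs q)) * M).
apply ex_RInt_gen_dominated with
  (D := fun s => K * (Rpower s (p + 1) * / (p + 1) + Rpower (1 - s) (q + 1) * - / (q + 1)))
  (d := fun s => K * (Rpower s p + Rpower (1 - s) q))
  (da := K * (0 * / (p + 1) + 1 * - / (q + 1)))
  (db := K * (1 * / (p + 1) + 0 * - / (q + 1))).
- lra.
- intros s Hs; apply (continuous_mult (K := R_AbsRing)).
  + now apply continuous_beta_weight.
  + now apply Hphi.
- intros s Hs.
  assert (H1 : is_derive (fun s => Rpower (1 - s) (q + 1)) s
     (- 1 * ((q + 1) * Rpower (1 - s) (q + 1 - 1)))).
  { apply is_derive_Rpower_comp; [lra|]; auto_derive; [trivial | ring]. }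
  assert (H0 : is_derive (fun s => Rpower s (p + 1)) s ((p + 1) * Rpower s (p + 1 - 1))).
  { apply is_derive_Rpower; lra. }
  replace (p + 1 - 1) with p in H0 by ring.
  replace (q + 1 - 1) with q in H1 by ring.
  evar_last.
  + apply is_derive_scal; apply (is_derive_plus (K := R_AbsRing) (V := R_NormedModule)).
    * exact (is_derive_scal_l (K := R_AbsRing) (V := R_NormedModule) _ s _ (/ (p + 1)) H0).
    * exact (is_derive_scal_l (K := R_AbsRing) (V := R_NormedModule) _ s _ (- / (q + 1)) H1).
  + unfold plus, scal; simpl; unfold mult; simpl; field; lra.
- intros s Hs.
  apply (continuous_mult (K := R_AbsRing) (fun _ => K)); [apply continuous_const|].
  apply (continuous_plus (V := R_NormedModule)).
  + apply continuous_Rpower; lra.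
  + apply (continuous_comp (fun s => 1 - s) (fun t => Rpower t q)).
    * apply (continuous_minus (V := R_NormedModule));
        [apply continuous_const | apply continuous_id].
    * apply continuous_Rpower; lra.
- intros s Hs; rewrite Rabs_mult, (Rabs_pos_eq (beta_weight p q s))
    by (left; apply beta_weight_pos).
  unfold K; rewrite (Rmult_comm (_ + _) M), Rmult_assoc, (Rmult_comm M).
  apply Rmult_le_compat.
  + left; apply beta_weight_pos.
  + apply Rabs_pos.
  + now apply beta_weight_le.
  + now apply HM.
- apply filterlim_Rmult; [apply filterlim_const|].
  apply filterlim_Rplus; (apply filterlim_Rmult; [|apply filterlim_const]).
  + apply filterlim_Rpower_0; lra.
  + apply (filterlim_comp _ _ _ _ (fun t => Rpower t (q + 1)) _ _ _
      filterlim_one_minus_at_right_0), filterlim_Rpower_at_left_1.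
- apply filterlim_Rmult; [apply filterlim_const|].
  apply filterlim_Rplus; (apply filterlim_Rmult; [|apply filterlim_const]).
  + apply filterlim_Rpower_at_left_1.
  + apply (filterlim_comp _ _ _ _ (fun t => Rpower t (q + 1)) _ _ _
      filterlim_one_minus_at_left_1), filterlim_Rpower_0; lra.
Qed.

Lemma is_RInt_gen_Beta (p q : R) : -1 < p -> -1 < q ->
  is_RInt_gen (beta_weight p q) (at_right 0) (at_left 1) (Beta p q).
Proof.
intros Hp Hq; apply (RInt_gen_correct (V := R_CompleteNormedModule)).
apply ex_RInt_gen_ext_eq with (fun s => beta_weight p q s * 1).
- intros s; apply Rmult_1_r.
- apply ex_RInt_gen_beta with 1; auto.
  + intros; apply continuous_const.
  + intros; rewrite Rabs_R1; lra.
Qed.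

(** The functional equation of the Beta function: the integral of the derivative
    of [beta_weight (p + 1) (q + 1)] vanishes. *)
Lemma Beta_succ (p q : R) : -1 < p -> -1 < q ->
  (p + q + 2) * Beta (p + 1) q = (p + 1) * Beta p q.
Proof.
intros Hp Hq.
assert (H0 : is_RInt_gen (Derive (beta_weight (p + 1) (q + 1)))
   (at_right 0) (at_left 1) (1 * 0 - 0 * 1)).
{ apply (is_RInt_gen_Derive (Fa := at_right 0) (Fb := at_left 1)).
  - generalize (filter_prod_Ioo 0 1 Rlt_0_1); apply filter_imp.
    intros [s t]; simpl; intros Hst x; rewrite Rmin_left, Rmax_right by lra; intros Hx.
    eexists; apply is_derive_beta_weight; lra.
  - generalize (filter_prod_Ioo 0 1 Rlt_0_1); apply filter_imp.
    intros [s t]; simpl; intros Hst x; rewrite Rmin_left, Rmax_right by lra; intros Hx.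
    apply continuous_ext_loc with
      (fun s => (p + 1) * beta_weight p q s - (p + q + 2) * beta_weight (p + 1) q s).
    + apply (locally_interval _ x 0 1); simpl; try lra.
      intros y Hy0 Hy1; symmetry; apply is_derive_unique, is_derive_beta_weight.
      simpl in *; lra.
    + apply (continuous_minus (V := R_NormedModule));
        apply (continuous_mult (K := R_AbsRing));
        try apply continuous_const; apply continuous_beta_weight; lra.
  - apply filterlim_Rmult; [apply filterlim_Rpower_0; lra|].
    apply (filterlim_comp _ _ _ _ (fun t => Rpower t (q + 1)) _ _ _
      filterlim_one_minus_at_right_0), filterlim_Rpower_at_left_1.
  - apply filterlim_Rmult; [apply filterlim_Rpower_at_left_1|].
    apply (filterlim_comp _ _ _ _ (fun t => Rpower t (q + 1)) _ _ _
      filterlim_one_minus_at_left_1), filterlim_Rpower_0; lra. }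
apply (is_RInt_gen_ext_Ioo 0 1 _
  (fun s => (p + 1) * beta_weight p q s - (p + q + 2) * beta_weight (p + 1) q s))
  in H0; [|lra|intros s Hs; now apply is_derive_unique, is_derive_beta_weight].
assert (H1 : is_RInt_gen
  (fun s => (p + 1) * beta_weight p q s - (p + q + 2) * beta_weight (p + 1) q s)
  (at_right 0) (at_left 1) ((p + 1) * Beta p q - (p + q + 2) * Beta (p + 1) q)).
{ apply (is_RInt_gen_minus (V := R_NormedModule));
    apply (is_RInt_gen_scal (V := R_NormedModule)); apply is_RInt_gen_Beta; lra. }
apply (is_RInt_gen_unique (V := R_CompleteNormedModule)) in H0.
apply (is_RInt_gen_unique (V := R_CompleteNormedModule)) in H1.
lra.
Qed.

Lemma Series_tail_le (a b : nat -> R) (N : nat) :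
  (forall k, Rabs (a k) <= b k) -> ex_series b ->
  Rabs (Series a - sum_n a N) <= Series b - sum_n b N.
Proof.
intros Hab Hb.
assert (Ha : ex_series a) by (now apply (ex_series_le (V := R_CompleteNormedModule)) with b).
rewrite (Series_incr_n a (S N)), (Series_incr_n b (S N)), !sum_n_Reals by (auto; lia).
simpl pred.
assert (Hb' : ex_series (fun k => b (S N + k)%nat)) by now apply ex_series_incr_n.
assert (Ha' : ex_series (fun k => Rabs (a (S N + k)%nat))).
{ apply (ex_series_le (V := R_CompleteNormedModule)) with (fun k => b (S N + k)%nat); auto.
  intros k; change (norm (Rabs ?x)) with (Rabs (Rabs x)); rewrite Rabs_Rabsolu; auto. }
replace (sum_f_R0 a N + Series (fun k => a (S N + k)%nat) - sum_f_R0 a N)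
  with (Series (fun k => a (S N + k)%nat)) by ring.
replace (sum_f_R0 b N + Series (fun k => b (S N + k)%nat) - sum_f_R0 b N)
  with (Series (fun k => b (S N + k)%nat)) by ring.
apply Rle_trans with (1 := Series_Rabs _ Ha').
apply Series_le; auto.
intros k; split; [apply Rabs_pos | auto].
Qed.

(** A power series is integrated term by term against the beta weight, because it
    converges uniformly on the segment from [0] to [u]. *)
Lemma is_pseries_beta_PSeries (p q u : R) (h : nat -> R) : -1 < p -> -1 < q ->
  Rbar_lt (Rabs u) (CV_radius h) ->
  exists l,
    is_RInt_gen (fun s => beta_weight p q s * PSeries h (u * s)) (at_right 0) (at_left 1) l /\
    is_pseries (fun j => h j * Beta (p + INR j) q) u l.
Proof.
intros Hp Hq Hu.
set (b := fun j => Rabs (h j * u ^ j)).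
assert (Hb : ex_series b) by now apply CV_disk_inside.
assert (Hle : forall s, 0 < s < 1 -> forall j, Rabs (h j * (u * s) ^ j) <= b j).
{ intros s Hs j; unfold b; rewrite Rpow_mult_distr, <- Rmult_assoc, Rabs_mult.
  rewrite <- (Rmult_1_r (Rabs (h j * u ^ j))) at 2.
  apply Rmult_le_compat_l; [apply Rabs_pos|].
  rewrite <- RPow_abs, Rabs_pos_eq by lra.
  rewrite <- (pow1 j); apply pow_incr; lra. }
assert (Hus : forall s, 0 < s < 1 -> Rbar_lt (Rabs (u * s)) (CV_radius h)).
{ intros s Hs; apply Rbar_le_lt_trans with (2 := Hu); simpl.
  rewrite Rabs_mult, (Rabs_pos_eq s) by lra.
  generalize (Rabs_pos u); nra. }
assert (Hcont : forall s, 0 < s < 1 -> continuous (fun s => PSeries h (u * s)) s).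
{ intros s Hs; apply (continuous_comp (fun s => u * s) (PSeries h)).
  - apply (continuous_mult (K := R_AbsRing)); [apply continuous_const | apply continuous_id].
  - now apply continuity_pt_filterlim, PSeries_continuity, Hus. }
assert (Hex : ex_RInt_gen (fun s => beta_weight p q s * PSeries h (u * s))
   (at_right 0) (at_left 1)).
{ apply ex_RInt_gen_beta with (Series b); auto.
  intros s Hs; unfold PSeries.
  assert (Ha : ex_series (fun k => Rabs (h k * (u * s) ^ k))).
  { apply CV_disk_inside; auto. }
  apply Rle_trans with (1 := Series_Rabs _ Ha).
  apply Series_le; auto; intros k; split; [apply Rabs_pos | auto]. }
apply (RInt_gen_correct (V := R_CompleteNormedModule)) in Hex.
set (l := RInt_gen _ _ _) in Hex; exists l; split; [exact Hex|].
set (c := fun j => h j * Beta (p + INR j) q * u ^ j).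
assert (Hpart : forall N, is_RInt_gen
  (fun s => beta_weight p q s * sum_n (fun j => h j * (u * s) ^ j) N)
  (at_right 0) (at_left 1) (sum_n c N)).
{ assert (Hterm : forall j, is_RInt_gen
    (fun s => beta_weight p q s * (h j * (u * s) ^ j)) (at_right 0) (at_left 1) (c j)).
  { intros j.
    apply (is_RInt_gen_ext_Ioo 0 1 (fun s => (h j * u ^ j) * beta_weight (p + INR j) q s)).
    - lra.
    - intros s Hs; rewrite beta_weight_addl, Rpow_mult_distr by lra; ring.
    - replace (c j) with ((h j * u ^ j) * Beta (p + INR j) q) by (unfold c; ring).
      apply (is_RInt_gen_scal (V := R_NormedModule)), is_RInt_gen_Beta; auto.
      generalize (pos_INR j); lra. }
  induction N as [|N IH].
  - rewrite sum_O; apply (is_RInt_gen_ext_Ioo 0 1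
      (fun s => beta_weight p q s * (h 0%nat * (u * s) ^ 0))); try lra; auto.
    intros s _; now rewrite sum_O.
  - rewrite sum_Sn.
    apply (is_RInt_gen_ext_Ioo 0 1
      (fun s => beta_weight p q s * sum_n (fun j => h j * (u * s) ^ j) N
                + beta_weight p q s * (h (S N) * (u * s) ^ S N))); try lra.
    + intros s _; rewrite sum_Sn; unfold plus; simpl; ring.
    + now apply (is_RInt_gen_plus (V := R_NormedModule)). }
assert (Hbound : forall N,
  Rabs (sum_n c N - l) <= (Series b - sum_n b N) * Beta p q).
{ intros N; rewrite Rabs_minus_sym.
  apply (RInt_gen_norm (V := R_CompleteNormedModule) (Fa := at_right 0) (Fb := at_left 1)
    (fun s => beta_weight p q s * PSeries h (u * s)
              - beta_weight p q s * sum_n (fun j => h j * (u * s) ^ j) N)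
    (fun s => (Series b - sum_n b N) * beta_weight p q s)).
  - generalize (filter_prod_Ioo 0 1 Rlt_0_1); apply filter_imp; intros; lra.
  - generalize (filter_prod_Ioo 0 1 Rlt_0_1); apply filter_imp.
    intros [x y]; simpl; intros Hxy s Hs.
    rewrite <- Rmult_minus_distr_l.
    change (norm ?x) with (Rabs x); rewrite Rabs_mult, Rmult_comm,
      (Rabs_pos_eq (beta_weight p q s)) by (left; apply beta_weight_pos).
    apply Rmult_le_compat_r; [left; apply beta_weight_pos|].
    apply Series_tail_le; auto; apply Hle; lra.
  - now apply (is_RInt_gen_minus (V := R_NormedModule)).
  - now apply (is_RInt_gen_scal (V := R_NormedModule)), is_RInt_gen_Beta. }
assert (Hlim : is_lim_seq (fun N => (Series b - sum_n b N) * Beta p q) 0).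
{ replace 0 with ((Series b - Series b) * Beta p q) by ring.
  apply (is_lim_seq_mult' _ (fun _ => Beta p q)); [|apply is_lim_seq_const].
  apply is_lim_seq_minus'; [apply is_lim_seq_const|].
  now apply Series_correct. }
apply is_series_ext with c.
{ intros j; rewrite pow_n_pow; unfold c, scal; simpl; unfold mult; simpl; ring. }
change (is_lim_seq (sum_n c) l).
apply is_lim_seq_ext with (fun N => (sum_n c N - l) + l).
{ intros N; unfold Rminus; now rewrite Rplus_assoc, Rplus_opp_l, Rplus_0_r. }
rewrite <- (Rplus_0_l l) at 1.
apply is_lim_seq_plus'; [|apply is_lim_seq_const].
apply is_lim_seq_abs_0, is_lim_seq_le_le with (u := fun _ => 0) (3 := Hlim).
- intros N; split; [apply Rabs_pos | apply Hbound].
- apply is_lim_seq_const.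
Qed.

(** * Power series *)

(** The terms of a convergent series tend to zero, which fails outside the disk of
    convergence. *)
Lemma CV_radius_ge (rho : R) (a : nat -> R) :
  (forall u, 0 < u < rho -> ex_pseries a u) -> Rbar_le rho (CV_radius a).
Proof.
intros H; apply Rbar_not_lt_le; intros Hlt.
assert (H0 := CV_radius_ge_0 a).
destruct (CV_radius a) as [c| |] eqn:Hc; simpl in Hlt, H0; try easy.
assert (Hu : 0 < (c + rho) / 2 < rho) by lra.
apply (CV_disk_outside a ((c + rho) / 2)).
- rewrite Hc, Rabs_pos_eq by lra; simpl; lra.
- apply is_lim_seq_ext with (fun n => scal (pow_n ((c + rho) / 2) n) (a n)).
  + intros n; rewrite pow_n_pow; unfold scal; simpl; unfold mult; simpl; ring.
  + apply ex_series_lim_0, (H _ Hu).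
Qed.

Lemma ex_pseries_lt_CV_radius (rho v : R) (a : nat -> R) :
  Rbar_le rho (CV_radius a) -> Rabs v < rho -> ex_pseries a v.
Proof.
intros Ha Hv; apply CV_radius_inside, Rbar_lt_le_trans with rho; auto.
Qed.

Lemma CV_radius_ge_plus (rho : R) (a b : nat -> R) :
  Rbar_le rho (CV_radius a) -> Rbar_le rho (CV_radius b) ->
  Rbar_le rho (CV_radius (PS_plus a b)).
Proof.
intros Ha Hb; apply CV_radius_ge; intros u Hu.
apply ex_pseries_plus; apply (ex_pseries_lt_CV_radius rho); auto;
  rewrite Rabs_pos_eq; lra.
Qed.

Lemma CV_radius_ge_scal (rho c : R) (a : nat -> R) :
  Rbar_le rho (CV_radius a) -> Rbar_le rho (CV_radius (PS_scal c a)).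
Proof.
intros Ha; apply CV_radius_ge; intros u Hu.
apply ex_pseries_scal; [apply Rmult_comm|].
apply (ex_pseries_lt_CV_radius rho); auto; rewrite Rabs_pos_eq; lra.
Qed.

(** The Euler operator [x d/dx] acts on power series by multiplying the [j]-th
    coefficient by [j]. *)
Definition PS_euler (a : nat -> R) : nat -> R := PS_incr_1 (PS_derive a).

Lemma PS_eulerE (a : nat -> R) (j : nat) : PS_euler a j = INR j * a j.
Proof.
destruct j as [|j].
- unfold PS_euler, zero; simpl; unfold zero; simpl; ring.
- reflexivity.
Qed.

Lemma PSeries_euler (a : nat -> R) (x : R) :
  PSeries (PS_euler a) x = x * PSeries (PS_derive a) x.
Proof. apply PSeries_incr_1. Qed.

Lemma CV_radius_euler (a : nat -> R) : CV_radius (PS_euler a) = CV_radius a.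
Proof. unfold PS_euler; now rewrite CV_radius_incr_1, CV_radius_derive. Qed.

(** * The binomial series *)

(** Taylor coefficients at [0] of [(2 - v)^mu], defined by the recurrence that the
    equation [(2 - v) y' = - mu y] imposes. *)
Fixpoint binomial_coef (mu : R) (j : nat) : R :=
  match j with
  | O => Rpower 2 mu
  | S j => (INR j - mu) / (2 * (INR j + 1)) * binomial_coef mu j
  end.

Lemma binomial_coef_succ (mu : R) (j : nat) :
  2 * (INR j + 1) * binomial_coef mu (S j) = (INR j - mu) * binomial_coef mu j.
Proof. simpl; field; generalize (pos_INR j); lra. Qed.

Lemma bounded_of_eventually_nonincreasing (x : nat -> R) (J : nat) :
  (forall j, (J <= j)%nat -> Rabs (x (S j)) <= Rabs (x j)) ->
  exists M, forall j, Rabs (x j) <= M.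
Proof.
intros H.
assert (HJ : exists M, forall j, (j <= J)%nat -> Rabs (x j) <= M).
{ clear H; induction J as [|J [M HM]].
  - exists (Rabs (x O)); intros j Hj; replace j with O by lia; apply Rle_refl.
  - exists (Rmax M (Rabs (x (S J)))); intros j Hj.
    destruct (Nat.eq_dec j (S J)) as [->|Hn]; [apply Rmax_r|].
    apply Rle_trans with (2 := Rmax_l _ _), HM; lia. }
destruct HJ as [M HM]; exists M; intros j.
induction j as [|j IH]; [apply HM; lia|].
destruct (Compare_dec.le_lt_dec (S j) J) as [Hj|Hj]; [now apply HM|].
apply Rle_trans with (2 := IH), H; lia.
Qed.

(** D'Alembert's test in a form that allows vanishing coefficients, which occur when
    [mu] is a natural number: for [rho < 2] the terms at [rho] eventually decrease in
    absolute value. *)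
Lemma CV_radius_binomial (mu : R) : Rbar_le 2 (CV_radius (binomial_coef mu)).
Proof.
apply CV_radius_ge; intros u Hu.
set (rho := (u + 2) / 2).
assert (Hrho : u < rho < 2) by (unfold rho; lra).
apply CV_radius_inside.
apply Rbar_lt_le_trans with rho; [simpl; rewrite Rabs_pos_eq; lra|].
apply CV_radius_bounded.
destruct (INR_unbounded (rho * Rabs mu / (2 - rho))) as [J HJ].
apply (bounded_of_eventually_nonincreasing _ J); intros j Hj.
apply le_INR in Hj; assert (Hj0 := pos_INR j).
(* beyond this index the ratio of consecutive terms is at most one *)
assert (Hratio : rho * Rabs (INR j - mu) <= 2 * (INR j + 1)).
{ assert (H : rho * Rabs mu < INR j * (2 - rho)).
  { replace (rho * Rabs mu) with (rho * Rabs mu / (2 - rho) * (2 - rho)) by (field; lra).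
    apply Rmult_lt_compat_r; lra. }
  assert (Ht : Rabs (INR j - mu) <= INR j + Rabs mu).
  { unfold Rminus; apply Rle_trans with (1 := Rabs_triang _ _).
    rewrite Rabs_Ropp, (Rabs_pos_eq (INR j)) by exact Hj0; lra. }
  apply Rle_trans with (rho * (INR j + Rabs mu)); [apply Rmult_le_compat_l; lra | lra]. }
replace (binomial_coef mu (S j) * rho ^ S j)
  with ((rho * (INR j - mu)) / (2 * (INR j + 1)) * (binomial_coef mu j * rho ^ j))
  by (simpl; field; lra).
rewrite Rabs_mult.
apply Rle_trans with (1 * Rabs (binomial_coef mu j * rho ^ j)); [|lra].
apply Rmult_le_compat_r; [apply Rabs_pos|].
unfold Rdiv; rewrite !Rabs_mult, (Rabs_pos_eq rho), (Rabs_pos_eq (/ _))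
  by (try lra; left; apply Rinv_0_lt_compat; lra).
apply Rmult_le_reg_r with (2 * (INR j + 1)); [lra|].
rewrite (Rmult_assoc _ (/ _)), Rinv_l by lra; lra.
Qed.

Lemma binomial_ODE (mu v : R) : Rabs v < 2 ->
  (2 - v) * PSeries (PS_derive (binomial_coef mu)) v = - mu * PSeries (binomial_coef mu) v.
Proof.
intros Hv; set (a := binomial_coef mu).
assert (Hr := CV_radius_binomial mu : Rbar_le 2 (CV_radius a)).
rewrite Rmult_minus_distr_r, <- PSeries_euler.
assert (H : PSeries (PS_scal 2 (PS_derive a)) v
  = PSeries (PS_plus (PS_euler a) (PS_scal (- mu) a)) v).
{ apply PSeries_ext; intros j; unfold PS_plus, PS_scal; rewrite PS_eulerE.
  change (PS_derive a j) with (INR (S j) * a (S j)); rewrite S_INR.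
  assert (E : 2 * (INR j + 1) * a (S j) = (INR j - mu) * a j)
    by apply binomial_coef_succ.
  clearbody a; unfold scal, plus; simpl; unfold mult; simpl; lra. }
rewrite PSeries_plus, !PSeries_scal in H.
- lra.
- apply (ex_pseries_lt_CV_radius 2); auto; now rewrite CV_radius_euler.
- apply (ex_pseries_lt_CV_radius 2); auto; now apply CV_radius_ge_scal.
Qed.

(** Both sides solve [(2 - v) y' = - mu y] with the same initial value, so that
    their quotient is constant. *)
Lemma PSeries_binomial (mu v : R) : 0 < v < 2 ->
  PSeries (binomial_coef mu) v = Rpower (2 - v) mu.
Proof.
intros Hv; set (A := PSeries (binomial_coef mu)).
assert (H : A 0 * Rpower (2 - 0) (- mu) = A v * Rpower (2 - v) (- mu)).
{ apply (eq_is_derive (V := R_NormedModule) (fun t => A t * Rpower (2 - t) (- mu)));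
    [intros t Ht | lra].
  assert (HA : is_derive A t (PSeries (PS_derive (binomial_coef mu)) t)).
  { apply is_derive_PSeries, Rbar_lt_le_trans with (2 := CV_radius_binomial mu).
    simpl; rewrite Rabs_pos_eq; lra. }
  assert (HR : is_derive (fun t => Rpower (2 - t) (- mu)) t
    (- 1 * (- mu * Rpower (2 - t) (- mu - 1)))).
  { apply is_derive_Rpower_comp; [lra|]; auto_derive; [trivial | ring]. }
  evar_last.
  - apply (is_derive_mult _ _ _ _ _ HA HR); intros; apply Rmult_comm.
  - unfold plus, mult, zero; simpl.
    rewrite (Rpower_pred (2 - t) (- mu)) by lra.
    assert (E : (2 - t) * PSeries (PS_derive (binomial_coef mu)) t = - mu * A t).
    { apply binomial_ODE; rewrite Rabs_pos_eq; lra. }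
    transitivity (Rpower (2 - t) (- mu - 1) *
      ((2 - t) * PSeries (PS_derive (binomial_coef mu)) t + mu * A t)); [ring|].
    rewrite E; ring. }
unfold A at 1 in H; rewrite PSeries_0 in H; simpl in H.
rewrite Rminus_0_r, !Rpower_Ropp, Rinv_r in H by (apply Rgt_not_eq, Rpower_pos).
assert (Hp := Rpower_pos (2 - v) mu).
apply Rmult_eq_reg_r with (/ Rpower (2 - v) mu); [|apply Rinv_neq_0_compat; lra].
rewrite <- H, Rinv_r; lra.
Qed.

(** * Repeated derivatives of a power times a power series *)

Fixpoint falling (z : R) (k : nat) : R :=
  match k with
  | O => 1
  | S k => (z - INR k) * falling z k
  end.

(** Both sides are the product of the [k + 1] factors [z + 1], [z], ..., [z + 1 - k]. *)
Lemma falling_succ (z : R) (k : nat) :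
  (z + 1 - INR k) * falling (z + 1) k = (z + 1) * falling z k.
Proof.
induction k as [|k IH]; [simpl; ring|].
change (falling (z + 1) (S k)) with ((z + 1 - INR k) * falling (z + 1) k).
change (falling z (S k)) with ((z - INR k) * falling z k).
rewrite IH, S_INR; ring.
Qed.

(** Coefficients of [v^(k - r)] times the [k]-th derivative of
    [v^r * PSeries a v]. *)
Definition PS_power_derive (r : R) (a : nat -> R) (k j : nat) : R :=
  falling (r + INR j) k * a j.

Lemma PS_power_derive_succ (r : R) (a : nat -> R) (k j : nat) :
  PS_power_derive r a (S k) j =
  PS_plus (PS_scal (r - INR k) (PS_power_derive r a k)) (PS_euler (PS_power_derive r a k)) j.
Proof.
unfold PS_plus, PS_scal; rewrite PS_eulerE.
unfold PS_power_derive, plus, scal; simpl; unfold mult; simpl; ring.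
Qed.

Lemma CV_radius_power_derive (rho r : R) (a : nat -> R) (k : nat) :
  Rbar_le rho (CV_radius a) -> Rbar_le rho (CV_radius (PS_power_derive r a k)).
Proof.
intros Ha; induction k as [|k IH].
- rewrite (CV_radius_ext _ a); auto; intros j; unfold PS_power_derive; simpl; ring.
- rewrite (CV_radius_ext _ _ (PS_power_derive_succ r a k)).
  apply CV_radius_ge_plus; [now apply CV_radius_ge_scal | now rewrite CV_radius_euler].
Qed.

(** One more derivative multiplies by [v^-1] and applies [r - k + v d/dv] to the series,
    which scales its [j]-th coefficient by [r - k + j]. *)
Lemma Derive_n_power_PSeries (rho r c : R) (a : nat -> R) (f : R -> R) (k : nat) :
  Rbar_le rho (CV_radius a) ->
  (forall t, c < t < c + rho -> f t = Rpower (t - c) r * PSeries a (t - c)) ->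
  forall t, c < t < c + rho ->
  Derive_n f k t = Rpower (t - c) (r - INR k) * PSeries (PS_power_derive r a k) (t - c).
Proof.
intros Ha Hf; induction k as [|k IH]; intros t Ht.
- simpl; rewrite Rminus_0_r, Hf by exact Ht; f_equal.
  apply PSeries_ext; intros j; unfold PS_power_derive; simpl; ring.
- set (h := PS_power_derive r a k) in *.
  assert (Hh : Rbar_le rho (CV_radius h)) by now apply CV_radius_power_derive.
  assert (Hv : Rabs (t - c) < rho) by (rewrite Rabs_pos_eq; lra).
  simpl Derive_n.
  rewrite (Derive_ext_loc _ (fun t => Rpower (t - c) (r - INR k) * PSeries h (t - c))).
  2:{ apply (locally_interval _ t c (c + rho)); simpl; try lra.
      intros y Hy1 Hy2; apply IH; simpl in *; lra. }
  apply is_derive_unique.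
  assert (HR : is_derive (fun t => Rpower (t - c) (r - INR k)) t
    (1 * ((r - INR k) * Rpower (t - c) (r - INR k - 1)))).
  { apply (is_derive_Rpower_comp (fun t => t - c)); [lra|]; auto_derive; [trivial | ring]. }
  assert (HP : is_derive (fun t => PSeries h (t - c)) t (1 * PSeries (PS_derive h) (t - c))).
  { apply (is_derive_comp (PSeries h) (fun t => t - c)).
    - apply is_derive_PSeries, Rbar_lt_le_trans with rho; auto.
    - auto_derive; [trivial | ring]. }
  evar_last.
  + apply (is_derive_mult _ _ _ _ _ HR HP); intros; apply Rmult_comm.
  + unfold plus, mult; simpl.
    rewrite (PSeries_ext _ _ _ (PS_power_derive_succ r a k)), PSeries_plus, PSeries_scal,
      PSeries_euler; fold h.
    * rewrite (Rpower_pred (t - c) (r - INR k)) by lra.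
      change (match k with O => 1 | S _ => INR k + 1 end) with (INR (S k)); rewrite S_INR.
      replace (r - INR k - 1) with (r - (INR k + 1)) by ring; ring.
    * apply (ex_pseries_lt_CV_radius rho); auto; now apply CV_radius_ge_scal.
    * apply (ex_pseries_lt_CV_radius rho); auto; now rewrite CV_radius_euler.
Qed.

(** * The hypergeometric equation *)

(** Up to rescaling the variable by [2], [g] is the coefficient sequence of the
    hypergeometric series with parameters [- mu], [r + 1] and [beta + 1].
    The recurrence is the equation read coefficient by coefficient: [2 j + 2 (beta + 1)]
    comes from the terms that lower the degree, [(j - mu) (j + r + 1)] from those that
    preserve it. *)
Lemma hypergeometric_ODE (mu r beta u : R) (g : nat -> R) :
  (forall j, 2 * (INR j + 1) * (beta + 1 + INR j) * g (S j)
             = (INR j - mu) * (r + 1 + INR j) * g j) ->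
  Rbar_le 2 (CV_radius g) -> Rabs u < 2 ->
  u * (2 - u) * PSeries (PS_derive (PS_derive g)) u
  + (2 * (beta + 1) - (r + 2 - mu) * u) * PSeries (PS_derive g) u
  + mu * (r + 1) * PSeries g u = 0.
Proof.
intros Hg Hr Hu; set (D := PS_derive g).
assert (HD : Rbar_le 2 (CV_radius D)) by (unfold D; now rewrite CV_radius_derive).
assert (H : PSeries (PS_plus (PS_scal 2 (PS_euler D)) (PS_scal (2 * (beta + 1)) D)) u
  = PSeries (PS_plus (PS_plus (PS_incr_1 (PS_euler D)) (PS_scal (r + 2 - mu) (PS_euler g)))
                     (PS_scal (- (mu * (r + 1))) g)) u).
{ apply PSeries_ext; intros j; unfold PS_plus, PS_scal; rewrite !PS_eulerE.
  replace (PS_incr_1 (PS_euler D) j) with ((INR j - 1) * INR j * g j).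
  - unfold scal, plus; simpl; unfold mult; simpl.
    change (D j) with (INR (S j) * g (S j)); rewrite S_INR.
    generalize (Hg j); intros E; lra.
  - destruct j as [|j].
    + simpl; unfold zero; simpl; ring.
    + change (PS_incr_1 (PS_euler D) (S j)) with (PS_euler D j); rewrite PS_eulerE.
      change (D j) with (INR (S j) * g (S j)); rewrite S_INR; ring. }
assert (Hin : forall b, Rbar_le 2 (CV_radius b) -> ex_pseries b u).
{ intros b Hb; now apply (ex_pseries_lt_CV_radius 2). }
rewrite !PSeries_plus, !PSeries_scal, PSeries_incr_1, !PSeries_euler in H.
- fold D in H; lra.
- apply Hin; now rewrite CV_radius_incr_1, CV_radius_euler.
- apply Hin, CV_radius_ge_scal; now rewrite CV_radius_euler.
- apply Hin, CV_radius_ge_plus.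
  + now rewrite CV_radius_incr_1, CV_radius_euler.
  + apply CV_radius_ge_scal; now rewrite CV_radius_euler.
- now apply Hin, CV_radius_ge_scal.
- apply Hin, CV_radius_ge_scal; now rewrite CV_radius_euler.
- now apply Hin, CV_radius_ge_scal.
Qed.

(** * The Caputo derivative of the Jacobi weight *)

Lemma Derive_n_jacobi_weight (mu r t : R) (k : nat) : -1 < t < 1 ->
  Derive_n (jacobi_weight mu r) k t =
  Rpower (t + 1) (r - INR k) * PSeries (PS_power_derive r (binomial_coef mu) k) (t + 1).
Proof.
intros Ht; replace (t + 1) with (t - - 1) by ring.
apply (Derive_n_power_PSeries 2); [apply CV_radius_binomial | | lra].
intros s Hs; unfold jacobi_weight; rewrite PSeries_binomial by lra.
rewrite Rmult_comm; f_equal; f_equal; ring.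
Qed.

(** The factor [Beta] is the integral of the [j]-th monomial against the beta weight.
    The normalising factor [/ Gamma (n - nu)] is left out. *)
Definition caputo_coef (n : nat) (nu alpha beta : R) (j : nat) : R :=
  PS_power_derive (nu + beta) (binomial_coef (nu + alpha)) n j
  * Beta (nu + beta - INR n + INR j) (INR n - nu - 1).

(** Substituting [t = -1 + (1 + x) s] brings out the factor
    [(1 + x)^(p + q + 1) = (1 + x)^beta] and leaves a beta integral. *)
Lemma caputo_jacobi_weight (n : nat) (nu alpha beta x : R) :
  INR n - 1 < nu < INR n -> 0 < beta -> -1 < x < 1 ->
  is_RInt_gen
    (fun t => Derive_n (jacobi_weight (nu + alpha) (nu + beta)) n t
              / Rpower (x - t) (nu + 1 - INR n)) (at_right (-1)) (at_left x)
    (Rpower (1 + x) beta * PSeries (caputo_coef n nu alpha beta) (1 + x))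
  /\ ex_pseries (caputo_coef n nu alpha beta) (1 + x).
Proof.
intros Hnu Hbeta Hx.
set (p := nu + beta - INR n); set (q := INR n - nu - 1); set (u := 1 + x).
set (h := PS_power_derive (nu + beta) (binomial_coef (nu + alpha)) n).
destruct (is_pseries_beta_PSeries p q u h) as [l [Hl Hs]].
- unfold p; lra.
- unfold q; lra.
- apply Rbar_lt_le_trans with 2.
  + unfold u; simpl; rewrite Rabs_pos_eq; lra.
  + apply CV_radius_power_derive, CV_radius_binomial.
- change (is_pseries (caputo_coef n nu alpha beta) u l) in Hs.
  split; [|now exists l].
  rewrite (is_pseries_unique _ _ _ Hs).
  apply (is_RInt_gen_affine (-1) x) in Hl; [|lra].
  apply (is_RInt_gen_scal (V := R_NormedModule) _ (Rpower u beta)) in Hl.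
  revert Hl; apply is_RInt_gen_ext_Ioo; [lra|].
  intros t Ht; unfold scal; simpl; unfold mult; simpl.
  rewrite Derive_n_jacobi_weight by lra; fold h; fold p.
  unfold Rdiv at 3; rewrite <- Rpower_Ropp.
  replace (- (nu + 1 - INR n)) with q by (unfold q; ring).
  replace (x - -1) with u by (unfold u; ring).
  replace (t - -1) with (t + 1) by ring.
  assert (Hu : 0 < u) by (unfold u; lra).
  replace (u * ((t + 1) / u)) with (t + 1) by (field; lra).
  assert (Hv : 0 < (t + 1) / u) by (apply Rdiv_lt_0_compat; lra).
  assert (Hw : 0 < 1 - (t + 1) / u).
  { replace (1 - (t + 1) / u) with ((x - t) / u) by (unfold u in *; field; lra).
    apply Rdiv_lt_0_compat; lra. }
  replace (Rpower (t + 1) p) with (Rpower u p * Rpower ((t + 1) / u) p)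
    by (rewrite Rpower_mult_distr by lra; f_equal; field; lra).
  replace (Rpower (x - t) q) with (Rpower u q * Rpower (1 - (t + 1) / u) q)
    by (rewrite Rpower_mult_distr by lra; f_equal; unfold u in *; field; lra).
  replace beta with (p + q + 1) by (unfold p, q; ring).
  rewrite Rpower_succ, Rpower_plus by exact Hu.
  unfold beta_weight; field; lra.
Qed.

(** The three factors of the coefficients contribute one recurrence each.  The factor
    [r + j + 1 - n] produced by the Beta function is absorbed by the falling
    factorial. *)
Lemma caputo_coef_succ (n : nat) (nu alpha beta : R) (j : nat) :
  INR n - 1 < nu < INR n -> 0 < beta ->
  2 * (INR j + 1) * (beta + 1 + INR j) * caputo_coef n nu alpha beta (S j)
  = (INR j - (nu + alpha)) * (nu + beta + 1 + INR j) * caputo_coef n nu alpha beta j.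
Proof.
intros Hnu Hbeta; assert (Hj := pos_INR j).
unfold caputo_coef, PS_power_derive.
set (r := nu + beta); set (q := INR n - nu - 1); set (a := binomial_coef (nu + alpha)).
assert (Ha : 2 * (INR j + 1) * a (S j) = (INR j - (nu + alpha)) * a j)
  by apply binomial_coef_succ.
rewrite S_INR.
replace (r - INR n + (INR j + 1)) with ((r - INR n + INR j) + 1) by ring.
replace (r + (INR j + 1)) with ((r + INR j) + 1) by ring.
set (p := r - INR n + INR j).
assert (HB : (p + q + 2) * Beta (p + 1) q = (p + 1) * Beta p q)
  by (apply Beta_succ; unfold p, q, r; lra).
replace (p + q + 2) with (beta + 1 + INR j) in HB by (unfold p, q, r; ring).
assert (HF := falling_succ (r + INR j) n).
replace (r + INR j + 1 - INR n) with (p + 1) in HF by (unfold p; ring).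
transitivity ((2 * (INR j + 1) * a (S j)) * falling (r + INR j + 1) n
  * ((beta + 1 + INR j) * Beta (p + 1) q)); [ring|].
rewrite HB, Ha.
transitivity ((INR j - (nu + alpha)) * a j
  * ((p + 1) * falling (r + INR j + 1) n) * Beta p q); [ring|].
rewrite HF; ring.
Qed.

(** Convergence is already known at every point of [(0, 2)], from the term-by-term
    integration. *)
Lemma CV_radius_caputo_coef (n : nat) (nu alpha beta : R) :
  INR n - 1 < nu < INR n -> 0 < beta ->
  Rbar_le 2 (CV_radius (caputo_coef n nu alpha beta)).
Proof.
intros Hnu Hbeta; apply CV_radius_ge; intros u Hu.
replace u with (1 + (u - 1)) by ring.
apply caputo_jacobi_weight; auto; lra.
Qed.

(** * The Jacobi equation *)

Lemma is_derive_Cmult_RtoC (K : C) (f : R -> R) (x l : R) : is_derive f x l ->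
  is_derive (fun t => (K * RtoC (f t))%C) x (K * RtoC l)%C.
Proof.
intros H.
assert (E : forall y : R, @scal R_AbsRing
  (prod_NormedModule R_AbsRing R_NormedModule R_NormedModule) y K = (K * RtoC y)%C).
{ intros y; destruct K as [a b]; unfold Cmult, RtoC, scal; simpl.
  unfold prod_scal, scal; simpl; unfold mult; simpl; f_equal; ring. }
rewrite <- E.
apply (is_derive_ext (fun t => @scal R_AbsRing
  (prod_NormedModule R_AbsRing R_NormedModule R_NormedModule) (f t) K)).
- intros t; apply E.
- now apply is_derive_scal_l.
Qed.

(** The derivative is again a combination of such products, with [alpha + 1] in place
    of [alpha], so that this lemma also yields the second derivative. *)
Lemma is_derive_shift_mult_Rpower (alpha x dF : R) (F : R -> R) : x < 1 ->
  is_derive F (1 + x) dF ->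
  is_derive (fun t => F (1 + t) * Rpower (1 - t) (- alpha)) x
    (dF * Rpower (1 - x) (- alpha) + alpha * F (1 + x) * Rpower (1 - x) (- (alpha + 1))).
Proof.
intros Hx HF.
assert (H1 : is_derive (fun t => F (1 + t)) x (1 * dF)).
{ apply (is_derive_comp F (fun t => 1 + t)); [exact HF | auto_derive; [trivial | ring]]. }
assert (H2 : is_derive (fun t => Rpower (1 - t) (- alpha)) x
  (- 1 * (- alpha * Rpower (1 - x) (- alpha - 1)))).
{ apply (is_derive_Rpower_comp (fun t => 1 - t)); [lra | auto_derive; [trivial | ring]]. }
evar_last.
- apply (is_derive_mult _ _ _ _ _ H1 H2); intros; apply Rmult_comm.
- unfold plus, mult; simpl.
  replace (- (alpha + 1)) with (- alpha - 1) by ring; ring.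
Qed.

(** With [F = (1 - x)^(- alpha) G (1 + x)], the left-hand side is [(1 - x)^(- alpha)] times
    the left-hand side of the equation of [G].  The powers of [1 - x] are first
    expressed through the lowest one. *)
Lemma jacobi_of_hypergeometric (nu alpha beta x G0 G1 G2 : R) : x < 1 ->
  (1 + x) * (2 - (1 + x)) * G2
  + (2 * (beta + 1) - (nu + beta + 2 - (nu + alpha)) * (1 + x)) * G1
  + (nu + alpha) * (nu + beta + 1) * G0 = 0 ->
  (1 - x ^ 2) * ((G2 * Rpower (1 - x) (- alpha)
                  + alpha * G1 * Rpower (1 - x) (- (alpha + 1)))
     + alpha * (G1 * Rpower (1 - x) (- (alpha + 1))
                + (alpha + 1) * G0 * Rpower (1 - x) (- (alpha + 1 + 1))))
  + (beta - alpha - (alpha + beta + 2) * x)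
    * (G1 * Rpower (1 - x) (- alpha) + alpha * G0 * Rpower (1 - x) (- (alpha + 1)))
  + nu * (nu + alpha + beta + 1) * (G0 * Rpower (1 - x) (- alpha)) = 0.
Proof.
intros Hx HG.
rewrite (Rpower_pred (1 - x) (- alpha)) by lra.
replace (- alpha - 1) with (- (alpha + 1)) by ring.
rewrite (Rpower_pred (1 - x) (- (alpha + 1))) by lra.
replace (- (alpha + 1) - 1) with (- (alpha + 1 + 1)) by ring.
match type of HG with ?E = 0 =>
  transitivity ((1 - x) ^ 2 * Rpower (1 - x) (- (alpha + 1 + 1)) * E);
    [ring | rewrite HG; ring] end.
Qed.

Theorem theorem3p8 (n : nat) (nu alpha beta : R)
  (hn : (1 <= n)%nat) (hnu : INR n - 1 < nu < INR n)
  (halpha : -1 < alpha) (hbeta : 0 < beta) :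
  exists y' y'' : R -> C,
    forall x : R, -1 < x < 1 ->
      is_derive (c_jacobi n nu alpha beta) x (y' x) /\
      is_derive y' x (y'' x) /\
      (RtoC (1 - x ^ 2) * y'' x
       + RtoC (beta - alpha - (alpha + beta + 2) * x) * y' x
       + RtoC (nu * (nu + alpha + beta + 1)) * c_jacobi n nu alpha beta x
       = RtoC 0)%C.
Proof.
set (g := caputo_coef n nu alpha beta).
assert (Hg : Rbar_le 2 (CV_radius g)) by now apply CV_radius_caputo_coef.
set (G0 := PSeries g); set (G1 := PSeries (PS_derive g)).
set (G2 := PSeries (PS_derive (PS_derive g))).
set (K := (minus_one_pow nu / RtoC (Rpower 2 nu * Gamma (nu + 1))
           * RtoC (/ Gamma (INR n - nu)))%C).
set (P := fun a x => Rpower (1 - x) (- a)).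
(* [Y0] is the real factor of the C-Jacobi function; [Y1] and [Y2] are its derivatives,
   in the form given by [is_derive_shift_mult_Rpower]. *)
set (Y0 := fun x => G0 (1 + x) * P alpha x).
set (Y1 := fun x => G1 (1 + x) * P alpha x + alpha * G0 (1 + x) * P (alpha + 1) x).
set (Y2 := fun x =>
  (G2 (1 + x) * P alpha x + alpha * G1 (1 + x) * P (alpha + 1) x)
  + alpha * (G1 (1 + x) * P (alpha + 1) x
             + (alpha + 1) * G0 (1 + x) * P (alpha + 1 + 1) x)).
assert (HY : forall x, -1 < x < 1 -> c_jacobi n nu alpha beta x = (K * RtoC (Y0 x))%C).
{ intros x Hx; unfold c_jacobi, caputo.
  destruct (caputo_jacobi_weight n nu alpha beta x hnu hbeta Hx) as [HI _].
  rewrite (is_RInt_gen_unique (V := R_CompleteNormedModule) _ _ HI).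
  fold g; fold (G0 (1 + x)).
  unfold K, Cdiv; rewrite <- (RtoC_inv (jacobi_weight alpha beta x))
    by (apply Rgt_not_eq, Rmult_lt_0_compat; apply Rpower_pos).
  rewrite <- !Cmult_assoc, <- !RtoC_mult; do 3 f_equal.
  unfold Y0, P, jacobi_weight; rewrite Rpower_Ropp.
  rewrite Rinv_mult; set (z := / Gamma _); clearbody z.
  field; split; apply Rgt_not_eq, Rpower_pos. }
assert (HG : forall x, -1 < x < 1 ->
  is_derive G0 (1 + x) (G1 (1 + x)) /\ is_derive G1 (1 + x) (G2 (1 + x))).
{ intros x Hx; assert (Hr : Rbar_lt (Rabs (1 + x)) (CV_radius g)).
  { apply Rbar_lt_le_trans with 2; auto; simpl; rewrite Rabs_pos_eq; lra. }
  split; apply is_derive_PSeries; auto; now rewrite CV_radius_derive. }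
exists (fun x => (K * RtoC (Y1 x))%C), (fun x => (K * RtoC (Y2 x))%C).
intros x Hx; destruct (HG x Hx) as [H0 H1]; split; [|split].
- apply is_derive_ext_loc with (fun x => (K * RtoC (Y0 x))%C).
  + apply (locally_interval _ x (-1) 1); simpl; try lra.
    intros y Hy1 Hy2; symmetry; apply HY; simpl in *; lra.
  + apply is_derive_Cmult_RtoC, is_derive_shift_mult_Rpower; auto; lra.
- apply is_derive_Cmult_RtoC.
  apply (is_derive_plus (K := R_AbsRing) (V := R_NormedModule)).
  + apply is_derive_shift_mult_Rpower; auto; lra.
  + apply is_derive_ext with (fun t => alpha * (G0 (1 + t) * P (alpha + 1) t)).
    { intros; simpl; ring. }
    apply is_derive_scal, is_derive_shift_mult_Rpower; auto; lra.
- rewrite HY by exact Hx.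
  transitivity (K * RtoC ((1 - x ^ 2) * Y2 x
    + (beta - alpha - (alpha + beta + 2) * x) * Y1 x
    + nu * (nu + alpha + beta + 1) * Y0 x))%C.
  { rewrite (RtoC_plus (_ + _)), RtoC_plus, !(RtoC_mult _ (_ x)); ring. }
  unfold Y0, Y1, Y2, P; rewrite jacobi_of_hypergeometric; [apply Cmult_0_r | lra |].
  apply hypergeometric_ODE; auto.
  + intros j; apply caputo_coef_succ; auto.
  + rewrite Rabs_pos_eq; lra.
Qed.
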